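(* Let $\{X_n\}$ be an absorbing random leap on $\{0,\dots,N\}$ with $N\ge k_p+k_q$, let $T=\min\{n\ge0:X_n\in\{0,N\}\}$ and $v_i=E(T\mid X_0=i)$. Then $\det(\mathbf A_N\mathbf Z)\ne 0$ and \[ v_i=\frac{\det(\mathbf A^\star_i\mathbf Z^\star)}{\det(\mathbf A_N\mathbf Z)}\qquad\text{for every } i\in\{0,\dots,N\}. \]
   Context: Fix an integer $k\ge1$ and nonnegative reals $p_1,\dots,p_k,q_1,\dots,q_k$ with $\sum_{j=1}^k(p_j+q_j)=1$, $\sum_{j=1}^k p_j>0$ and $\sum_{j=1}^k q_j>0$. Let $k_p=\max\{j:p_j>0\}$ and $k_q=\max\{j:q_j>0\}$. Let $\xi$ be a random variable with $P(\xi=\ell)=p_\ell$ and $P(\xi=-\ell)=q_\ell$ for $1\le\ell\le k$. For an integer $N\ge k_p+k_q$, the absorbing random leap is the Markov chain on $\{0,\dots,N\}$ in which $0$ and $N$ are absorbing and, for $0<i<N$: $P(i\to j)=P(i+\xi=j)$ for $1\le j\le N-1$, $P(i\to0)=P(i+\xi\le0)$, $P(i\to N)=P(i+\xi\ge N)$. Characteristic polynomial: $\chi(z)=\sum_{j=0}^{2k-1}c_jz^j$ where $c_j=-\sum_{\ell=k-j}^k q_\ell$ for $0\le j\le k-1$ and $c_j=\sum_{\ell=j-k+1}^k p_\ell$ for $k\le j\le 2k-1$. Counted with multiplicity, $\chi$ has exactly $r:=k_p+k_q-1$ nonzero roots; let $z_1,\dots,z_s$ be the distinct nonzero roots with multiplicities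 $r_1,\dots,r_s$. For each $j$ let $\mathbf Z^{(j)}$ be the $(N+r-1)\times r_j$ matrix with entries $Z^{(j)}_{i,\ell}=(i+1-k_q)^{\ell-1}z_j^{\,i+1-k_q}$ ($1\le i\le N+r-1$), with $0^0=1$, and $\mathbf Z=(\mathbf Z^{(1)}\ \cdots\ \mathbf Z^{(s)})$. Accordion matrix: for $i\in\{0,\dots,N\}$, $\mathbf A_i=\begin{pmatrix}I_{k_q-1}&0&0&0\\0&\mathbf 1_i^T&\mathbf 0_{N-i}^T&0\\0&0&0&I_{k_p-1}\end{pmatrix}$, an $r\times(N+r-1)$ matrix (column blocks of widths $k_q-1,i,N-i,k_p-1$). Extended accordion matrix: $\mathbf A^\star_i$ is the $(r+1)\times(N+r-1)$ matrix obtained by appending to $\mathbf A_N$ the $k_q$-th row of $\mathbf A_i$ (the row with ones in columns $k_q,\dots,k_q+i-1$ and zeros elsewhere) as a last row. Let $\mu=\sum_{j=1}^k j(p_j-q_j)$ and $\sigma^2=\sum_{j=1}^k j^2(p_j+q_j)-\mu^2$. Let $\boldsymbol\delta=(\delta_{2-k_q},\delta_{3-k_q},\dots,\delta_{N+k_p-1})^T$ (length $N+r-1$) with $\delta_i=-1/\mu$ if $\mu\ne0$ and $\delta_i=-2i/\sigma^2$ if $\mu=0$. Let $\mathbf Z^\star=(\mathbf Z\ \ \boldsymbol\delta)$, an $(N+r-1)\times(r+1)$ matrix. *)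

(* Defs.v *)
From HB Require Import structures.
From mathcomp Require Import all_boot all_order all_algebra.
Unset Printing Implicit Defensive.
Import Order.TTheory GRing.Theory Num.Theory.
Local Open Scope ring_scope.

Section RandomLeap.
Context {C : archiClosedFieldType}.

(* Step distribution: P(xi = l) = p l, P(xi = -l) = q l, for 1 <= l <= k;
   values of p, q outside 1..k are irrelevant. *)

Definition rl_kmax (k : nat) (p : nat -> C) : nat :=
  (\max_(1 <= j < k.+1 | (0 < p j)%R) j)%N.

Definition rl_rnum (k : nat) (p q : nat -> C) : nat := (rl_kmax k p + rl_kmax k q).-1.

Definition leap_trans (k N : nat) (p q : nat -> C) : 'M[C]_N.+1 :=
  \matrix_(i < N.+1, j < N.+1)
    if (i == 0%N :> nat) || (i == N :> nat) then ((i : nat) == j)%:R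
    else if (j == 0%N :> nat) then \sum_(1 <= l < k.+1 | (i <= l)%N) q l
    else if (j == N :> nat) then \sum_(1 <= l < k.+1 | (N <= i + l)%N) p l
    else \sum_(1 <= l < k.+1 | (i + l == j)%N) p l
       + \sum_(1 <= l < k.+1 | (j + l == i)%N) q l.

(* P(T > n | X_0 = i) = P(X_n not in {0,N} | X_0 = i)  (0, N absorbing) *)
Definition rl_tail_prob (k N : nat) (p q : nat -> C) (i : 'I_N.+1) (n : nat) : C :=
  \sum_(j < N.+1 | (0 < j < N)%N) ((leap_trans k N p q) ^+ n) i j.

Definition rl_series_to (a : nat -> C) (l : C) : Prop :=
  forall e : C, 0 < e -> exists M : nat, forall m : nat, (M <= m)%N ->
    `| \sum_(n < m) a n - l | < e.

(* v = E(T | X_0 = i) = sum_{n >= 0} P(T > n | X_0 = i) (finite). *)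
Definition expected_absorption_time (k N : nat) (p q : nat -> C)
    (i : 'I_N.+1) (v : C) : Prop :=
  rl_series_to (rl_tail_prob k N p q i) v.

Definition rl_char_coef (k : nat) (p q : nat -> C) (j : nat) : C :=
  if (j < k)%N then - \sum_(k - j <= l < k.+1) q l
  else \sum_(j - k + 1 <= l < k.+1) p l.

Definition rl_char_poly (k : nat) (p q : nat -> C) : {poly C} :=
  \poly_(j < (2 * k).-1.+1) rl_char_coef k p q j.

(* Column c (0-based) of Z, at the point x = i + 1 - k_q: the columns are
   grouped into consecutive blocks, one per (z_j, r_j) in the list zm. *)
Fixpoint rl_zcol (zm : seq (C * nat)) (c : nat) (x : int) : C :=
  match zm with
  | [::] => 0
  | (z, m) :: zm' =>
      if (c < m)%N then (x%:~R) ^+ c * z ^ x else rl_zcol zm' (c - m) x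
  end.

Definition rl_mu (k : nat) (p q : nat -> C) : C :=
  \sum_(1 <= j < k.+1) j%:R * (p j - q j).

Definition rl_sigma2 (k : nat) (p q : nat -> C) : C :=
  \sum_(1 <= j < k.+1) (j%:R ^+ 2) * (p j + q j) - (rl_mu k p q) ^+ 2.

Definition rl_delta_entry (k : nat) (p q : nat -> C) (x : int) : C :=
  if rl_mu k p q != 0 then - (rl_mu k p q)^-1
  else - (2 * x%:~R) / rl_sigma2 k p q.

(* index x = i + 1 - k_q, for 1-based row index i = a + 1 *)
Definition rl_row_pt (k : nat) (p q : nat -> C) (a : nat) : int :=
  (a%:Z + 2%:Z - (rl_kmax k q)%:Z)%R.

Definition rl_dimZ (k N : nat) (p q : nat -> C) : nat := (N + rl_rnum k p q - 1)%N.

(* Z : (N+r-1) x r, with the list zs of distinct nonzero roots *)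
Definition rl_Zmat (k N : nat) (p q : nat -> C) (zs : seq C) :
    'M[C]_(rl_dimZ k N p q, rl_rnum k p q) :=
  \matrix_(a < rl_dimZ k N p q, c < rl_rnum k p q)
    rl_zcol [seq (z, mup z (rl_char_poly k p q)) | z <- zs] c (rl_row_pt k p q a).

Definition rl_Zstar (k N : nat) (p q : nat -> C) (zs : seq C) :
    'M[C]_(rl_dimZ k N p q, (rl_rnum k p q).+1) :=
  \matrix_(a < rl_dimZ k N p q, c < (rl_rnum k p q).+1)
    if (c < rl_rnum k p q)%N then
      rl_zcol [seq (z, mup z (rl_char_poly k p q)) | z <- zs] c (rl_row_pt k p q a)
    else rl_delta_entry k p q (rl_row_pt k p q a).

Definition rl_acc_entry (k N : nat) (p q : nat -> C) (i a b : nat) : C :=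
  let kq := rl_kmax k q in
  if (a < kq - 1)%N then (a == b)%:R
  else if (a == kq - 1)%N then ((kq - 1 <= b)%N && (b < kq - 1 + i)%N)%:R
  else (b == a + N - 1)%N%:R.

Definition rl_Amat (k N : nat) (p q : nat -> C) (i : nat) :
    'M[C]_(rl_rnum k p q, rl_dimZ k N p q) :=
  \matrix_(a < rl_rnum k p q, b < rl_dimZ k N p q) rl_acc_entry k N p q i a b.

Definition rl_Astar (k N : nat) (p q : nat -> C) (i : nat) :
    'M[C]_((rl_rnum k p q).+1, rl_dimZ k N p q) :=
  \matrix_(a < (rl_rnum k p q).+1, b < rl_dimZ k N p q)
    if (a < rl_rnum k p q)%N then rl_acc_entry k N p q N a b
    else rl_acc_entry k N p q i (rl_kmax k q - 1)%N b.

End RandomLeap.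

(* Main.v *)
Require Import Defs.
From HB Require Import structures.
From mathcomp Require Import all_boot all_order all_algebra.
From mathcomp Require Import zify ring.
Import Order.TTheory GRing.Theory Num.Theory.
Local Open Scope ring_scope.

(** Let [D x = u x - u (x - 1)] be the increments of a function [u].  The
    generator [E (u (x + xi) - u x)] is the recurrence in [D] whose
    characteristic polynomial is [chi], so the columns of [Z] solve the
    homogeneous recurrence and [delta] solves it with right-hand side [-1].
    Clipping the leaps at [0] and [N] amounts to [D] vanishing on the points
    selected by the outer rows of the accordion matrix, and its middle row
    encodes [u N = u 0 = 0].

    If [A_N Z w = 0], then [Z w] are the increments of a harmonic function of
    the absorbing chain that vanishes at [0] and [N]; such a function is [0],
    and [w = 0] because the columns of [Z] are linearly independent on [r]
    consecutive points.  So [w] can be chosen with [A_N (Z w + delta) = 0], and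
    [v_i] is the sum of the first [i] entries of [Z w + delta] from the point
    [1] on; Cramer's rule turns this into the quotient of determinants.

    Convergence and uniqueness both come from the Lyapunov function [b ^+ x]
    with [b = 2 / P(xi > 0)], whose mean grows by at least [1] at every step
    taken before absorption. *)

(** * Exponential polynomials *)

(** Formally [X^(-y) (X d/dX) X^y]: each application multiplies the coefficient of [X^i] by [y + i],
    which produces the polynomial factors in the columns of [Z]. *)
Definition euler_op {R : comNzRingType} (y : R) (g : {poly R}) : {poly R} :=
  y *: g + 'X * g^`().

Lemma coef_iter_euler_op (R : comNzRingType) (y : R) (l : nat) (g : {poly R}) (i : nat) :
  (iter l (euler_op y) g)`_i = (y + i%:R) ^+ l * g`_i.
Proof.
elim: l => [|l IHl]; first by rewrite mul1r.
rewrite iterS coefD coefZ coefXM coef_deriv exprS -mulrA -IHl mulrDl.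
by case: i {IHl} => [|i] /=; rewrite mulr_natl.
Qed.

Lemma horner_iter_euler_op (R : comNzRingType) (y z : R) (l n : nat) (g : {poly R}) :
  (size g <= n)%N ->
  (iter l (euler_op y) g).[z] = \sum_(i < n) g`_i * ((y + i%:R) ^+ l * z ^+ i).
Proof.
move=> le_gn; rewrite (@horner_coef_wide _ n); last first.
  apply/leq_sizeP => j le_nj; rewrite coef_iter_euler_op.
  by rewrite (leq_sizeP _ _ le_gn) ?mulr0.
by apply: eq_bigr => i _; rewrite coef_iter_euler_op; ring.
Qed.

(** The product rule: one application costs a single order of vanishing at [z], and the term that
    realises this loss carries the exponent and a factor ['X]. *)
Lemma euler_op_root_factor (R : comNzRingType) (y z : R) (m : nat) (psi : {poly R}) :
  euler_op y (('X - z%:P) ^+ m.+1 * psi) =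
  ('X - z%:P) ^+ m * (m.+1%:R *: ('X * psi) + ('X - z%:P) * euler_op y psi).
Proof.
rewrite /euler_op derivM deriv_exp derivXsubC mul1r /= exprS -!mul_polyC.
by rewrite -[_ ^+ m *+ _]mulr_natl polyC_natr; ring.
Qed.

Lemma iter_euler_op_root (R : comNzRingType) (y z : R) (l m : nat) (psi : {poly R}) :
  (l < m)%N -> (iter l (euler_op y) (('X - z%:P) ^+ m * psi)).[z] = 0.
Proof.
elim: l m psi => [|l IHl] [|m] psi // lt_lm.
  by rewrite /= exprS !hornerE subrr !mul0r.
by rewrite iterSr euler_op_root_factor IHl.
Qed.

Lemma iter_euler_op_diag (R : comNzRingType) (y z : R) (t : nat) (psi : {poly R}) :
  (iter t (euler_op y) (('X - z%:P) ^+ t * psi)).[z] = t`!%:R * z ^+ t * psi.[z].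
Proof.
elim: t psi => [|t IHt] psi; first by rewrite expr0 mul1r fact0 !mul1r.
rewrite iterSr euler_op_root_factor IHt !hornerE subrr mul0r addr0 factS exprS.
by rewrite natrM /=; ring.
Qed.

(** Links recurrences to root multiplicities: the recurrence with coefficients [g] kills [x^l z^x]
    as soon as [z] is a root of [g] of order above [l]. *)
Lemma sum_shift_expPoly (F : numFieldType) (z : F) (x : int) (l n : nat) (g : {poly F}) :
  z != 0 -> (size g <= n)%N ->
  \sum_(i < n) g`_i * ((x + i%:Z)%:~R ^+ l * z ^ (x + i%:Z)) =
  z ^ x * (iter l (euler_op x%:~R) g).[z].
Proof.
move=> nz_z le_gn; rewrite (@horner_iter_euler_op _ _ _ _ n) // mulr_sumr.
by apply: eq_bigr => i _; rewrite expfzDr // -exprnP intrD -pmulrn; ring.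
Qed.

Section ExponentialPolynomials.
Context {C : archiClosedFieldType}.
Implicit Types (zm : seq (C * nat)) (g : {poly C}) (a : nat -> C) (x : int).

Lemma sum_shift_zcol_eq0 zm g c n x :
  (size g <= n)%N ->
  (forall z m, (z, m) \in zm -> z != 0 /\ ('X - z%:P) ^+ m %| g) ->
  \sum_(i < n) g`_i * rl_zcol zm c (x + i%:Z) = 0.
Proof.
move=> le_gn; elim: zm c => [|[z m] zm IHzm] c dvd_g /=.
  by rewrite big1 // => i _; rewrite mulr0.
have [lt_cm | le_mc] := ltnP c m; last first.
  by apply: IHzm => z' m' in_zm; apply: dvd_g; rewrite inE in_zm orbT.
have [nz_z /dvdpP[psi Dg]] := dvd_g z m (mem_head _ _).
by rewrite sum_shift_expPoly // Dg [psi * _]mulrC iter_euler_op_root ?mulr0.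
Qed.

Lemma sum_zcol_cons z m zm a x :
  \sum_(c < (m + sumn (unzip2 zm))%N) a c * rl_zcol ((z, m) :: zm) c x =
  \sum_(c < m) a c * (x%:~R ^+ c * z ^ x)
  + \sum_(c < sumn (unzip2 zm)) a (m + c)%N * rl_zcol zm c x.
Proof.
rewrite big_split_ord /=; congr (_ + _).
  by apply: eq_bigr => c _; rewrite ltn_ord.
by apply: eq_bigr => c _; rewrite ltnNge leq_addr addKn.
Qed.

Lemma size_prod_XsubC_exp zm :
  size (\prod_(u <- zm) ('X - u.1%:P) ^+ u.2) = (sumn (unzip2 zm)).+1.
Proof.
elim: zm => [|[z m] zm IHzm]; first by rewrite big_nil size_poly1.
rewrite big_cons size_monicM ?monic_exp ?monicXsubC //; last first.
  by rewrite -size_poly_eq0 IHzm.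
by rewrite IHzm size_exp_XsubC /= addnS.
Qed.

(** Induction on the blocks: polynomials vanishing to full order at the later roots isolate the
    first block, where powers of ['X - z%:P] give a triangular system. *)
Lemma zcol_free zm a x :
  uniq (unzip1 zm) -> (forall z, z \in unzip1 zm -> z != 0) ->
  (forall i, (i < sumn (unzip2 zm))%N ->
     \sum_(c < sumn (unzip2 zm)) a c * rl_zcol zm c (x + i%:Z) = 0) ->
  forall c, (c < sumn (unzip2 zm))%N -> a c = 0.
Proof.
elim: zm a => [|[z m] zm IHzm] a //.
set S := sumn (unzip2 zm); rewrite [unzip1 _]/= [sumn _]/= -/S /=.
move=> /andP[zNzm uniq_zm] nz_zm comb0.
have nz_z : z != 0 by apply: nz_zm; rewrite mem_head.
set h : {poly C} := \prod_(u <- zm) ('X - u.1%:P) ^+ u.2.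
have hz_neq0 : h.[z] != 0.
  rewrite horner_prod; rewrite prodf_seq_neq0; apply/allP => -[z' m'] /= in_zm.
  rewrite !hornerE expf_neq0 // subr_eq0; apply: contraNneq zNzm => ->.
  by apply/mapP; exists (z', m').
(* The factor [h] makes [g] annihilate the later blocks. The degree of [g] stays below [m + S], so
   only the points [x], ..., [x + m + S - 1] of the hypothesis occur. *)
have test t : (t < m)%N ->
    \sum_(c < m) a c * (iter c (euler_op x%:~R) (('X - z%:P) ^+ t * h)).[z] = 0.
  move=> lt_tm; set g := _ * h.
  have le_g : (size g <= m + S)%N.
    rewrite size_monicM ?monic_exp ?monicXsubC //; last first.
      by rewrite -size_poly_eq0 size_prod_XsubC_exp.
    by rewrite size_prod_XsubC_exp size_exp_XsubC addnS /= -/S ltn_add2r.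
  have tail0 c : \sum_(i < (m + S)%N) g`_i * rl_zcol zm c (x + i%:Z) = 0.
    apply: sum_shift_zcol_eq0 => // z' m' in_zm; split.
      by apply: nz_zm; rewrite inE; apply/orP; right; apply/mapP; exists (z', m').
    by apply: dvdp_mull; rewrite /h (big_rem _ in_zm) dvdp_mulr.
  have: \sum_(i < (m + S)%N) g`_i * 
     (\sum_(c < (m + S)%N) a c * rl_zcol ((z, m) :: zm) c (x + i%:Z)) = 0.
    by rewrite big1 // => i _; rewrite comb0 ?mulr0.
  under eq_bigr => i _ do rewrite sum_zcol_cons mulrDr !mulr_sumr.
  rewrite big_split /= exchange_big [X in _ + X]exchange_big /= -/S.
  rewrite [X in _ + X]big1 ?addr0 => [|c _]; last first.
    by under eq_bigr do rewrite mulrCA; rewrite -mulr_sumr tail0 mulr0.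
  move=> head0; apply/(mulfI (expfz_neq0 x nz_z)); rewrite mulr0 -[RHS]head0 mulr_sumr.
  apply: eq_bigr => c _; under [RHS]eq_bigr do rewrite mulrCA.
  by rewrite -mulr_sumr sum_shift_expPoly // mulrCA.
(* Back substitution from [c = m - 1] downwards: testing with [t = c] kills the lower terms, the
   higher coefficients are already 0, and the diagonal entry [c! z^c h(z)] is nonzero. *)
have head0 n : forall c, (m <= c + n)%N -> (c < m)%N -> a c = 0.
  elim: n => [|n IHn] c; first by rewrite addn0 leqNgt => /negP.
  move=> le_mcn lt_cm; have := test c lt_cm.
  rewrite (bigD1 (Ordinal lt_cm)) //= iter_euler_op_diag big1 => [|d neq_dc].
    rewrite addr0 => /eqP; rewrite mulf_eq0 => /orP[/eqP // |].
    by rewrite !mulf_eq0 (negPf hz_neq0) expf_eq0 (negPf nz_z) andbF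
      pnatr_eq0 eqn0Ngt fact_gt0.
  have [lt_dc | le_cd] := ltnP d c; first by rewrite iter_euler_op_root ?mulr0.
  have lt_cd : (c < d)%N by rewrite ltn_neqAle le_cd andbT eq_sym; exact: neq_dc.
  by rewrite IHn ?mul0r //; lia.
have {}head0 c : (c < m)%N -> a c = 0 by apply: (head0 m); rewrite leq_addl.
move=> c lt_c; have [/head0 // | le_mc] := ltnP c m.
rewrite -(subnKC le_mc); apply: (IHzm (fun c => a (m + c)%N)) => //; last first.
- by rewrite ltn_subLR.
- move=> i lt_i; rewrite -/S.
  have lt_i' : (i < m + S)%N by rewrite ltn_addl.
  have := comb0 i lt_i'; rewrite sum_zcol_cons big1 ?add0r // => d _.
  by rewrite head0 ?mul0r.
- by move=> z' z'_zm; apply: nz_zm; rewrite inE z'_zm orbT.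
Qed.

End ExponentialPolynomials.

(** * Stochastic matrices *)

Section StochasticMatrix.
Context {C : archiClosedFieldType} {N : nat}.
Variable P : 'M[C]_N.+1.
Hypothesis P_ge0 : forall i j, 0 <= P i j.
Hypothesis P_sum1 : P *m const_mx 1 = const_mx 1 :> 'cV_N.+1.
Implicit Types u v : 'cV[C]_N.+1.

Lemma expmx_ge0 n i j : 0 <= (P ^+ n) i j.
Proof.
elim: n i j => [|n IHn] i j; first by rewrite expr0 mxE ler0n.
by rewrite exprS mxE sumr_ge0 // => l _; rewrite mulr_ge0.
Qed.

Lemma ler_expmx_mul n u v i :
  (forall j, u j 0 <= v j 0) -> (P ^+ n *m u) i 0 <= (P ^+ n *m v) i 0.
Proof.
by move=> le_uv; rewrite !mxE ler_sum // => j _; rewrite ler_wpM2l ?expmx_ge0.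
Qed.

Lemma expmx_mul_const n (c : C) : P ^+ n *m const_mx c = const_mx c :> 'cV_N.+1.
Proof.
have ->: const_mx c = c *: const_mx 1 :> 'cV[C]_N.+1.
  by apply/matrixP => i j; rewrite !mxE mulr1.
rewrite -scalemxAr; congr (_ *: _).
by elim: n => [|n IHn]; rewrite ?expr0 ?mul1mx // exprSr -[_ * _]/(_ *m _) -mulmxA P_sum1.
Qed.

Lemma expmx_mulS n u : P ^+ n.+1 *m u = P ^+ n *m (P *m u).
Proof. by rewrite exprSr mulmxA. Qed.

(** Telescoping. It serves with [s = -1] for the expected time and with [s = 0] for harmonic
    functions. *)
Lemma sum_expmx_mul (e u : 'cV[C]_N.+1) (s : C) m :
  P *m u - u = s *: e ->
  s *: \sum_(n < m) P ^+ n *m e = P ^+ m *m u - u.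
Proof.
move=> Pu; elim: m => [|m IHm]; first by rewrite big_ord0 scaler0 expr0 mul1mx subrr.
rewrite big_ord_recr scalerDr {}IHm /= scalemxAr -Pu mulmxBr -expmx_mulS.
by rewrite addrC addrA subrK.
Qed.

(** * Decay from a bounded Lyapunov function *)

Variables (e f : 'cV[C]_N.+1) (B : C).
Hypothesis Pe_le : forall i, (P *m e) i 0 <= e i 0.
Hypothesis f_ge0 : forall i, 0 <= f i 0.
Hypothesis f_leB : forall i, f i 0 <= B.
Hypothesis Pf_ge : forall i, f i 0 + e i 0 <= (P *m f) i 0.

(** Iterating [Pf_ge] bounds [f] plus the sum by [P ^+ m *m f], and averaging keeps the latter below
    [B]. *)
Lemma sum_expmx_le m i : \sum_(n < m) (P ^+ n *m e) i 0 <= B.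
Proof.
have le_f: f i 0 + \sum_(n < m) (P ^+ n *m e) i 0 <= (P ^+ m *m f) i 0.
  elim: m => [|m IHm]; first by rewrite big_ord0 addr0 expr0 mul1mx.
  rewrite big_ord_recr /= addrA expmx_mulS; apply: le_trans (lerD IHm (lexx _)) _.
  have <- : (P ^+ m *m (f + e)) i 0 = (P ^+ m *m f) i 0 + (P ^+ m *m e) i 0.
    by rewrite mulmxDr mxE.
  by apply: ler_expmx_mul => j; rewrite mxE.
apply: le_trans (_ : (P ^+ m *m f) i 0 <= B).
  by apply: le_trans le_f; rewrite lerDr.
have <- : (P ^+ m *m (const_mx B : 'cV_N.+1)) i 0 = B by rewrite expmx_mul_const mxE.
by apply: ler_expmx_mul => j; rewrite mxE.
Qed.

(** The terms [P ^+ n *m e] are nonincreasing in [n], so their sum over [n < m] is at least [m]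
    times the value at time [m]. *)
Lemma expmx_mul_le m i : m%:R * (P ^+ m *m e) i 0 <= B.
Proof.
apply: le_trans (sum_expmx_le m i).
have noninc n : (P ^+ n.+1 *m e) i 0 <= (P ^+ n *m e) i 0.
  by rewrite expmx_mulS; apply: ler_expmx_mul.
rewrite mulr_natl -[X in _ *+ X]card_ord -sumr_const; apply: ler_sum => n _.
have: (n <= m)%N by apply: ltnW.
elim: m {n}(n : nat) => [|m IHm] n; first by rewrite leqn0 => /eqP->.
rewrite leq_eqVlt => /predU1P[-> // | lt_nm].
exact: le_trans (noninc m) (IHm _ lt_nm).
Qed.

Lemma expmx_mul_cvg0 u i (eps : C) :
  (forall j, e j 0 = 0 -> u j 0 = 0) -> (forall j, e j 0 != 0 -> e j 0 = 1) ->
  0 < eps -> exists M, forall m, (M <= m)%N -> `|(P ^+ m *m u) i 0| < eps.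
Proof.
(* Where [e] vanishes so does [u], and elsewhere [e] is 1, whence [|u| <= U * e]; any [m] above
   [U * B / eps] then suffices. *)
move=> u0 e1 eps_gt0; pose U := \sum_j `|u j 0|.
have U_ge0 : 0 <= U by rewrite sumr_ge0.
have le_u j : `|u j 0| <= U * e j 0.
  have [ej0 | /e1 ->] := eqVneq (e j 0) 0; first by rewrite u0 // ej0 normr0 mulr0.
  by rewrite mulr1 /U (bigD1 j) //= lerDl sumr_ge0.
have le_Pu m : `|(P ^+ m *m u) i 0| <= U * (P ^+ m *m e) i 0.
  rewrite !mxE mulr_sumr; apply: le_trans (ler_norm_sum _ _ _) _.
  apply: ler_sum => j _; rewrite normrM ger0_norm ?expmx_ge0 // mulrCA.
  by rewrite ler_wpM2l ?expmx_ge0.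
have B_ge0 : 0 <= B by apply: le_trans (f_leB i).
have x_ge0 : 0 <= U * B / eps by rewrite !mulr_ge0 // invr_ge0 ltW.
exists (Num.Def.archi_bound (U * B / eps)) => m le_m.
have lt_m : U * B / eps < m%:R.
  by apply: lt_le_trans (archi_boundP x_ge0) _; rewrite ler_nat.
have m_gt0 : 0 < m%:R :> C by apply: le_lt_trans lt_m.
rewrite -(ltr_pM2l m_gt0); apply: le_lt_trans (_ : U * B < _); last first.
  by rewrite -ltr_pdivrMr.
apply: le_trans (ler_wpM2l (ltW m_gt0) (le_Pu m)) _; rewrite mulrCA.
by rewrite ler_wpM2l ?expmx_mul_le.
Qed.

End StochasticMatrix.

(** * The absorbing chain *)

Section AbsorbingLeap.
Context {C : archiClosedFieldType} (k N : nat) (p q : nat -> C).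
Local Notation P := (leap_trans k N p q).

(** The separate cases for the columns [0], [N] and the others merge: [minn] clips upward leaps,
    truncated subtraction clips downward ones. *)
Lemma leap_trans_interior (i j : 'I_N.+1) : (0 < i < N)%N ->
  P i j = \sum_(1 <= l < k.+1)
    (p l * (minn (i + l) N == j)%:R + q l * ((i - l)%N == j)%:R).
Proof.
move=> /andP[i_gt0 lt_iN]; rewrite mxE (gtn_eqF i_gt0) (ltn_eqF lt_iN) /=.
rewrite big_split /=; have le_jN := ltn_ord j.
have sum_if (c : pred nat) (d : pred nat) (h : nat -> C) :
    (forall l, (1 <= l)%N -> c l = d l) ->
    \sum_(1 <= l < k.+1) h l * (c l)%:R = \sum_(1 <= l < k.+1 | d l) h l.
  move=> eq_cd; rewrite [RHS]big_mkcond /= big_nat [RHS]big_nat.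
  by apply: eq_bigr => l /andP[/eq_cd-> _]; case: (d l); rewrite ?mulr1 ?mulr0.
have [j0 | nz_j] := eqVneq (j : nat) 0%N.
  rewrite j0 (sum_if _ pred0) ?big_pred0_eq ?add0r => [|l _]; last by rewrite /=; lia.
  by rewrite (sum_if _ (fun l => i <= l)%N) // => l _ /=; lia.
have [jN | neq_jN] := eqVneq (j : nat) N.
  rewrite jN (sum_if _ (fun l => N <= i + l)%N) => [|l _]; last by rewrite /=; lia.
  by rewrite (sum_if _ pred0) ?big_pred0_eq ?addr0 // => l _ /=; lia.
rewrite (sum_if _ (fun l => i + l == j)%N) => [|l _]; last by rewrite /=; lia.
by rewrite (sum_if _ (fun l => j + l == i)%N) // => l _ /=; lia.
Qed.

Lemma leap_mul_interior (u : nat -> C) (i : 'I_N.+1) : (0 < i < N)%N ->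
  (P *m \col_j u j) i 0 =
  \sum_(1 <= l < k.+1) (p l * u (minn (i + l) N) + q l * u (i - l)%N).
Proof.
move=> int_i; rewrite mxE.
under eq_bigr => j _ do rewrite leap_trans_interior // mxE mulr_suml.
rewrite exchange_big /=; apply: eq_bigr => l _.
have pick_at (n : nat) (a : C) : (n <= N)%N ->
    \sum_(j < N.+1) a * (n == j)%:R * u j = a * u n.
  move=> le_nN; rewrite (bigD1 (Ordinal (le_nN : n < N.+1)%N)) //= eqxx mulr1.
  rewrite big1 ?addr0 // => j neq_j; rewrite -val_eqE /= eq_sym in neq_j.
  by rewrite (negPf neq_j) mulr0 mul0r.
under eq_bigr do rewrite mulrDl.
by rewrite big_split /= !pick_at //; have := ltn_ord i; lia.
Qed.

Lemma leap_mul_absorbing (u : 'cV[C]_N.+1) (i : 'I_N.+1) :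
  ~~ (0 < i < N)%N -> (P *m u) i 0 = u i 0.
Proof.
move=> abs_i; have i_abs : (i == 0%N :> nat) || (i == N :> nat).
  by have := ltn_ord i; lia.
rewrite mxE (bigD1 i) //= mxE i_abs eqxx mul1r big1 ?addr0 // => j neq_ji.
by rewrite mxE i_abs eq_sym val_eqE (negPf neq_ji) mul0r.
Qed.

Hypothesis p_ge0 : forall j, (1 <= j <= k)%N -> 0 <= p j.
Hypothesis q_ge0 : forall j, (1 <= j <= k)%N -> 0 <= q j.
Hypothesis pq_sum1 : \sum_(1 <= j < k.+1) (p j + q j) = 1.
Hypothesis p_gt0 : 0 < \sum_(1 <= j < k.+1) p j.

Definition interior_cv : 'cV[C]_N.+1 := \col_j (0 < j < N)%N%:R.

Lemma leap_trans_ge0 i j : 0 <= P i j.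
Proof.
have [int_i | abs_i] := boolP (0 < i < N)%N; last first.
  rewrite mxE ifT ?ler0n //; have := ltn_ord i; lia.
rewrite leap_trans_interior // big_nat sumr_ge0 // => l le_l.
by rewrite addr_ge0 // mulr_ge0 ?ler0n ?p_ge0 ?q_ge0.
Qed.

Lemma leap_trans_sum1 : P *m const_mx 1 = const_mx 1 :> 'cV_N.+1.
Proof.
apply/matrixP => i c; rewrite ord1.
have [int_i | abs_i] := boolP (0 < i < N)%N; last by rewrite leap_mul_absorbing.
have -> : const_mx 1 = \col_(j < N.+1) (fun _ => 1) (j : nat) :> 'cV[C]_N.+1.
  by apply/matrixP => j d; rewrite !mxE.
rewrite (leap_mul_interior (fun=> 1)) // mxE -[RHS]pq_sum1.
by apply: eq_bigr => l _; rewrite !mulr1.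
Qed.

Lemma leap_interior_le i : (P *m interior_cv) i 0 <= interior_cv i 0.
Proof.
have [int_i | abs_i] := boolP (0 < i < N)%N; last by rewrite leap_mul_absorbing.
have -> : interior_cv i 0 = (P *m (const_mx 1 : 'cV_N.+1)) i 0.
  by rewrite leap_trans_sum1 !mxE int_i.
rewrite mxE [leRHS]mxE ler_sum // => j _; rewrite ler_wpM2l ?leap_trans_ge0 //.
by rewrite !mxE lern1 leq_b1.
Qed.

Let pbar := \sum_(1 <= j < k.+1) p j.
Let b := 2 / pbar.

Lemma growth_rate_ge1 : 1 <= b.
Proof.
rewrite /b ler_pdivlMr // mul1r; apply: le_trans (_ : 1 <= 2); last by rewrite ler1n.
by rewrite -pq_sum1 big_split /= lerDl big_nat sumr_ge0.
Qed.

(* Already the upward steps multiply the mean of [b ^+ X] by [pbar * b = 2]. *)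
Lemma leap_growth (i : 'I_N.+1) :
  b ^+ i + interior_cv i 0 <= (P *m \col_(j < N.+1) b ^+ j) i 0.
Proof.
have b_ge0 : 0 <= b by apply: le_trans growth_rate_ge1.
have [int_i | abs_i] := boolP (0 < i < N)%N; last first.
  by rewrite leap_mul_absorbing // !mxE (negPf abs_i) addr0.
rewrite (leap_mul_interior (fun n => b ^+ n)) // mxE int_i.
(* Downward leaps are discarded and, as [b >= 1], upward leaps are shortened to length 1, which
   clipping at [N] leaves intact. *)
apply: le_trans (_ : \sum_(1 <= l < k.+1) p l * b ^+ i.+1 <= _); last first.
  rewrite [leLHS]big_nat [leRHS]big_nat ler_sum // => l le_l.
  apply: le_trans (_ : p l * b ^+ minn (i + l) N <= _); last first.
    by rewrite lerDl mulr_ge0 ?q_ge0 ?exprn_ge0.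
  by rewrite ler_wpM2l ?p_ge0 // ler_weXn2l ?growth_rate_ge1 //; lia.
have pbar_b : pbar * b = 2 by rewrite /b mulrCA mulfV ?mulr1 // lt0r_neq0.
by rewrite -mulr_suml -/pbar exprS mulrA pbar_b mulr_natl mulr2n lerD2l
  exprn_ege1 ?growth_rate_ge1.
Qed.

Lemma leap_mul_cvg0 (u : nat -> C) i (eps : C) : u 0%N = 0 -> u N = 0 -> 0 < eps ->
  exists M, forall m, (M <= m)%N -> `|(P ^+ m *m \col_(j < N.+1) u j) i 0| < eps.
Proof.
move=> u0 uN eps_gt0.
have b_ge0 : 0 <= b by apply: le_trans growth_rate_ge1.
apply: (@expmx_mul_cvg0 _ _ P leap_trans_ge0 leap_trans_sum1 interior_cv
          (\col_(j < N.+1) b ^+ j) (b ^+ N)) => //.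
- exact: leap_interior_le.
- by move=> j; rewrite mxE exprn_ge0.
- by move=> j; rewrite mxE ler_weXn2l ?growth_rate_ge1 // -ltnS.
- by move=> j; rewrite mxE; apply: leap_growth.
- move=> j; rewrite !mxE => /eqP; rewrite pnatr_eq0 eqb0 => abs_j.
  have [-> // | ->] : (j : nat) = 0%N \/ (j : nat) = N by have := ltn_ord j; lia.
  by [].
- by move=> j; rewrite mxE; case: (_ && _); rewrite ?eqxx.
Qed.

Lemma rl_tail_probE i n : rl_tail_prob k N p q i n = (P ^+ n *m interior_cv) i 0.
Proof.
rewrite /rl_tail_prob mxE big_mkcond /=; apply: eq_bigr => j _.
by rewrite mxE; case: (_ && _); rewrite ?mulr1 ?mulr0.
Qed.

Lemma leap_mul_sub (u : nat -> C) (s : C) :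
  (forall i, (0 < i < N)%N ->
     \sum_(1 <= l < k.+1)
       (p l * (u (minn (i + l) N) - u i) + q l * (u (i - l)%N - u i)) = s) ->
  P *m (\col_j u j) - \col_j u j = s *: interior_cv.
Proof.
move=> Lu; apply/matrixP => i c; rewrite ord1 mxE [X in _ + X]mxE [X in _ - X]mxE.
rewrite [RHS]mxE [X in _ = _ * X]mxE.
have [int_i | abs_i] := boolP (0 < i < N)%N; last first.
  by rewrite leap_mul_absorbing // mxE subrr mulr0.
rewrite leap_mul_interior // mulr1 -(Lu i int_i) -[u i in LHS]mul1r -[X in X * _]pq_sum1.
rewrite mulr_suml -sumrB; apply: eq_bigr => l _; ring.
Qed.

(** By telescoping, the partial sums of the tail probabilities are [u i] minus the mean of [u] at
    time [m], which tends to 0 because [u] vanishes at both barriers. *)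
Lemma absorption_time_potential (u : nat -> C) :
  u 0%N = 0 -> u N = 0 ->
  (forall i, (0 < i < N)%N ->
     \sum_(1 <= l < k.+1)
       (p l * (u (minn (i + l) N) - u i) + q l * (u (i - l)%N - u i)) = -1) ->
  forall i : 'I_N.+1, expected_absorption_time k N p q i (u i).
Proof.
move=> u0 uN /leap_mul_sub/sum_expmx_mul Psum i eps eps_gt0.
have [M Pu_lt] := leap_mul_cvg0 u i eps u0 uN eps_gt0; exists M => m /Pu_lt.
under eq_bigr do rewrite rl_tail_probE.
have Pi : - \sum_(n < m) (P ^+ n *m interior_cv) i 0 =
    (P ^+ m *m \col_(j < N.+1) u j) i 0 - u i.
  have /matrixP/(_ i 0) := Psum m; rewrite scaleN1r mxE summxE => ->.
  by rewrite mxE [X in _ + X]mxE [X in _ - X]mxE.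
have -> : (P ^+ m *m \col_(j < N.+1) u j) i 0 =
    u i - \sum_(n < m) (P ^+ n *m interior_cv) i 0.
  by rewrite addrC Pi subrK.
by rewrite distrC.
Qed.

Lemma harmonic_eq0 (u : nat -> C) :
  u 0%N = 0 -> u N = 0 ->
  (forall i, (0 < i < N)%N ->
     \sum_(1 <= l < k.+1)
       (p l * (u (minn (i + l) N) - u i) + q l * (u (i - l)%N - u i)) = 0) ->
  forall i, (i <= N)%N -> u i = 0.
Proof.
move=> u0 uN /leap_mul_sub/sum_expmx_mul Psum i le_iN.
apply/eqP; apply: contraT; rewrite -normr_gt0 => u_gt0.
pose i' := Ordinal (le_iN : i < N.+1)%N.
(* With [|u i|] itself as tolerance, invariance of [u] under the powers of the transition matrix
   gives [|u i| < |u i|]. *)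
have [M /(_ M (leqnn _))] := leap_mul_cvg0 u i' `|u i| u0 uN u_gt0.
have /esym/eqP := Psum M; rewrite scale0r subr_eq0 => /eqP->.
by rewrite mxE ltxx.
Qed.

End AbsorbingLeap.

(** * The generator in terms of increments *)

Section Generator.
Context {C : archiClosedFieldType} (k N : nat) (p q : nat -> C).
Local Notation kp := (rl_kmax k p).
Local Notation kq := (rl_kmax k q).
Local Notation chi := (rl_char_poly k p q).

(* The generator [E(u(x + xi) - u(x))] of the free walk, written in terms of
   the increments [D x = u x - u (x - 1)]. *)
Definition rl_gen (D : int -> C) (x : int) : C :=
  \sum_(1 <= l < k.+1) (p l * (\sum_(m < l) D (x + m.+1%:Z))
                        - q l * (\sum_(m < l) D (x - m%:Z))).

Lemma eq_rl_gen (D E : int -> C) x : D =1 E -> rl_gen D x = rl_gen E x.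
Proof.
move=> eqDE; apply: eq_bigr => l _.
by congr (_ * _ - _ * _); apply: eq_bigr => m _; rewrite eqDE.
Qed.

Lemma rl_genD (D E : int -> C) x :
  rl_gen (fun y => D y + E y) x = rl_gen D x + rl_gen E x.
Proof.
by rewrite /rl_gen -big_split; apply: eq_bigr => l _; rewrite !big_split /=; ring.
Qed.

Lemma rl_gen_lincomb n (a : 'I_n -> C) (D : 'I_n -> int -> C) x :
  rl_gen (fun y => \sum_(c < n) a c * D c y) x = \sum_(c < n) a c * rl_gen (D c) x.
Proof.
rewrite /rl_gen; under [RHS]eq_bigr do rewrite mulr_sumr.
rewrite [RHS]exchange_big; apply: eq_bigr => l _ /=.
rewrite exchange_big [X in _ - _ * X]exchange_big !mulr_sumr -sumrB.
by apply: eq_bigr => c _; rewrite -!mulr_sumr; ring.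
Qed.

Lemma sum_tail_exchange (n : nat) (a E : nat -> C) :
  \sum_(m < n) (\sum_(m.+1 <= l < n.+1) a l) * E m =
  \sum_(1 <= l < n.+1) a l * \sum_(m < l) E m.
Proof.
elim: n => [|n IHn]; first by rewrite big_ord0 big_geq.
rewrite [RHS]big_nat_recr //= -IHn big_ord_recr /= [X in _ + X * _]big_nat1.
rewrite [in RHS]big_ord_recr /= mulrDr addrA; congr (_ + _).
rewrite mulr_sumr -big_split /=; apply: eq_bigr => m _.
by rewrite big_nat_recr 1?mulrDl // ltnS ltnW.
Qed.

(** The coefficients of [chi] are tail sums of [p] and [q]; exchanging the order of summation
    collects, for each increment, all leaps that cross it. *)
Lemma rl_gen_char_poly (D : int -> C) x : (0 < k)%N ->
  \sum_(j < (2 * k).-1.+1) chi`_j * D (x + 1 - k%:Z + j%:Z) = rl_gen D x.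
Proof.
move=> k_gt0; have Dk : (2 * k).-1.+1 = (k + k)%N by lia.
under eq_bigr => j _ do rewrite coef_poly ltn_ord.
rewrite {}Dk big_split_ord /= addrC /rl_gen sumrB.
rewrite -(sum_tail_exchange k p (fun m => D (x + m.+1%:Z))).
rewrite -(sum_tail_exchange k q (fun m => D (x - m%:Z))) -sumrN.
congr (_ + _).
  apply: eq_bigr => t _; rewrite /rl_char_coef ltnNge leq_addr /= addKn addn1.
  by congr (_ * D _); lia.
(* For [j < k] the tail of [q] starts at [k - j], so the downward increments occur in reverse
   order. *)
rewrite (reindex_inj rev_ord_inj) /=; apply: eq_bigr => m _.
rewrite /rl_char_coef ifT; last by have := ltn_ord m; lia.
rewrite subKn // mulNr; congr (- (_ * D _)).
by have := ltn_ord m; lia.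
Qed.

Lemma rl_gen_zcol (zm : seq (C * nat)) c x : (0 < k)%N ->
  (forall z m, (z, m) \in zm -> z != 0 /\ ('X - z%:P) ^+ m %| chi) ->
  rl_gen (rl_zcol zm c) x = 0.
Proof.
move=> k_gt0 dvd_chi; rewrite -rl_gen_char_poly //.
by apply: sum_shift_zcol_eq0 => //; apply: size_poly.
Qed.

Lemma sum_ord_natr (n : nat) : 2 * (\sum_(m < n) m%:R) = n%:R * (n%:R - 1) :> C.
Proof.
elim: n => [|n IHn]; first by rewrite big_ord0 mul0r mulr0.
by rewrite big_ord_recr mulrDr IHn /= -natr1; ring.
Qed.

Lemma rl_gen_const (a : C) x : rl_gen (fun=> a) x = rl_mu k p q * a.
Proof.
rewrite /rl_mu mulr_suml; apply: eq_bigr => l _.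
by rewrite !sumr_const card_ord -[_ *+ l]mulr_natl; ring.
Qed.

Lemma rl_gen_id x : rl_mu k p q = 0 ->
  2 * rl_gen (fun y => y%:~R) x = rl_sigma2 k p q.
Proof.
move=> mu0; rewrite /rl_sigma2 mu0 expr0n /= subr0.
(* Adding [2x + 1] times the vanishing mean makes the identity hold separately for each leap length
   [l]. *)
have -> : \sum_(1 <= j < k.+1) j%:R ^+ 2 * (p j + q j) =
    \sum_(1 <= j < k.+1) j%:R ^+ 2 * (p j + q j) + (2 * x%:~R + 1) * rl_mu k p q.
  by rewrite mu0 mulr0 addr0.
rewrite /rl_mu !mulr_sumr -big_split /=; apply: eq_bigr => l _.
have -> : \sum_(m < l) (x + m.+1%:Z)%:~R = l%:R * (x%:~R + 1) + \sum_(m < l) m%:R :> C.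
  rewrite mulr_natl -[X in _ *+ X]card_ord -sumr_const -big_split /=.
  by apply: eq_bigr => m _; rewrite intrD -pmulrn -natr1; ring.
have -> : \sum_(m < l) (x - m%:Z)%:~R = l%:R * x%:~R - \sum_(m < l) m%:R :> C.
  rewrite mulr_natl -[X in _ *+ X]card_ord -sumr_const -sumrB /=.
  by apply: eq_bigr => m _; rewrite intrB -pmulrn.
have sum_l := sum_ord_natr l; set s := \sum_(m < l) _ in sum_l *.
transitivity (2 * s * (p l + q l) + 2 * l%:R * (p l * (x%:~R + 1) - q l * x%:~R)).
  by ring.
by rewrite sum_l; ring.
Qed.

Hypothesis p_ge0 : forall j, (1 <= j <= k)%N -> 0 <= p j.
Hypothesis q_ge0 : forall j, (1 <= j <= k)%N -> 0 <= q j.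
Hypothesis pq_sum1 : \sum_(1 <= j < k.+1) (p j + q j) = 1.

(** Leap lengths are at least 1, so the second moment is at least the total mass 1. *)
Lemma rl_sigma2_neq0 : rl_mu k p q = 0 -> rl_sigma2 k p q != 0.
Proof.
move=> mu0; rewrite /rl_sigma2 mu0 expr0n /= subr0; apply: lt0r_neq0.
apply: lt_le_trans ltr01 _; rewrite -[leLHS]pq_sum1 [leLHS]big_nat [leRHS]big_nat.
apply: ler_sum => l le_l; rewrite ler_peMl ?addr_ge0 ?p_ge0 ?q_ge0 //.
by rewrite -natrX ler1n expn_gt0; case/andP: le_l => ->.
Qed.

Lemma rl_gen_delta x : rl_gen (rl_delta_entry k p q) x = -1.
Proof.
have [mu0 | nz_mu] := eqVneq (rl_mu k p q) 0; last first.
  rewrite (@eq_rl_gen _ (fun=> - (rl_mu k p q)^-1)) => [|y].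
    by rewrite rl_gen_const mulrN mulfV.
  by rewrite /rl_delta_entry nz_mu.
have nz_s := rl_sigma2_neq0 mu0; set a := - 2 / rl_sigma2 k p q.
rewrite (@eq_rl_gen _ (fun y => \sum_(c < 1) a * y%:~R)) => [|y].
  rewrite (rl_gen_lincomb 1 (fun=> a) (fun _ y => y%:~R)) big_ord1 /a.
  by rewrite mulrAC mulNr rl_gen_id // mulNr mulfV.
by rewrite /rl_delta_entry mu0 eqxx big_ord1 /a !mulNr mulrAC.
Qed.

Lemma rl_kmaxP (h : nat -> C) : (forall j, (1 <= j <= k)%N -> 0 <= h j) ->
  0 < \sum_(1 <= j < k.+1) h j ->
  [/\ (1 <= rl_kmax k h <= k)%N, 0 < h (rl_kmax k h) &
      forall l, (rl_kmax k h < l <= k)%N -> h l = 0].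
Proof.
move=> h_ge0 sum_gt0.
have le_kmax l : (1 <= l <= k)%N -> 0 < h l -> (l <= rl_kmax k h)%N.
  by move=> le_l h_gt0; apply: (@leq_bigmax_seq _ _ _ id); rewrite ?mem_index_iota.
have h0 l : (1 <= l <= k)%N -> ~~ (0 < h l) -> h l = 0.
  move=> le_l; rewrite lt_neqAle h_ge0 // andbT negbK => /eqP-> //.
have [l le_l hl_gt0] : exists2 l, (1 <= l <= k)%N & 0 < h l.
  have /hasP[l] : has (fun l => 0 < h l) (index_iota 1 k.+1).
    apply: contraLR sum_gt0 => /hasPn hN; rewrite big_seq big1 ?ltxx // => l in_l.
    by apply: h0 (hN _ in_l); rewrite mem_index_iota in in_l.
  by rewrite mem_index_iota => le_l; exists l.
have kmax_in : (1 <= rl_kmax k h <= k)%N && (0 < h (rl_kmax k h)).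
  (* An empty maximum is 0, so the invariant has to admit this value; the witness [l] excludes it
     afterwards. *)
  have : (rl_kmax k h == 0)%N || ((1 <= rl_kmax k h <= k)%N && (0 < h (rl_kmax k h))).
    rewrite {1 2 3 4}/rl_kmax big_seq_cond.
    apply: (big_ind (fun m => (m == 0)%N || ((1 <= m <= k)%N && (0 < h m)))) => //.
      by move=> m n Hm Hn; rewrite /maxn; case: ifP.
    by move=> m; rewrite mem_index_iota => /andP[-> ->]; rewrite orbT.
  by case/orP=> // /eqP kmax0; have := le_kmax l le_l hl_gt0; lia.
case/andP: kmax_in => kmax_in hk_gt0; split=> // m lt_m.
by apply: h0; [lia | apply: contraTN isT => /le_kmax]; lia.
Qed.

(** A leap from [i < N] of length at most [kp] ends no later than [N + kp - 1], and the increments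
    met beyond [N] vanish. *)
Lemma clipped_sum_up (D : int -> C) (i l : nat) :
  (forall x : int, N%:Z + 1 <= x <= N%:Z + kp%:Z - 1 -> D x = 0) ->
  (i < N)%N -> (l <= kp)%N ->
  \sum_(m < minn (i + l) N) D m.+1%:Z - \sum_(m < i) D m.+1%:Z =
  \sum_(m < l) D (i%:Z + m.+1%:Z).
Proof.
move=> D0 lt_iN; elim: l => [|l IHl] le_l.
  by rewrite big_ord0 addn0 (minn_idPl (ltnW lt_iN)) subrr.
rewrite big_ord_recr /= -IHl; last exact: ltnW.
have [lt_ilN | le_Nil] := ltnP (i + l) N.
  have -> : minn (i + l.+1) N = (i + l).+1 by lia.
  by rewrite big_ord_recr /= -PoszD addnS addrAC.
have -> : minn (i + l.+1) N = N by lia.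
by rewrite [D (_ + _)]D0 ?addr0 //; lia.
Qed.

(** A leap from [i > 0] of length at most [kq] ends no earlier than [1 - kq], so it meets only
    increments from [2 - kq] on, which vanish up to 0. *)
Lemma clipped_sum_down (D : int -> C) (i l : nat) :
  (forall x : int, 2 - kq%:Z <= x <= 0 -> D x = 0) ->
  (0 < i)%N -> (l <= kq)%N ->
  \sum_(m < i - l) D m.+1%:Z - \sum_(m < i) D m.+1%:Z = - \sum_(m < l) D (i%:Z - m%:Z).
Proof.
move=> D0 i_gt0; elim: l => [|l IHl] le_l.
  by rewrite subn0 big_ord0 subrr oppr0.
rewrite big_ord_recr /= opprD -IHl; last exact: ltnW.
have [lt_li | le_il] := ltnP l i.
  have -> : (i - l)%N = (i - l.+1).+1 by lia.
  rewrite big_ord_recr /=; have -> : (i - l.+1).+1%:Z = i%:Z - l%:Z by lia.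
  ring.
have -> : (i - l.+1)%N = (i - l)%N by lia.
by rewrite [D (_ - _)]D0 ?subr0 //; lia.
Qed.

Hypothesis p_gt0 : 0 < \sum_(1 <= j < k.+1) p j.
Hypothesis q_gt0 : 0 < \sum_(1 <= j < k.+1) q j.

Lemma clipped_gen (D : int -> C) (u : nat -> C) :
  (forall x : int, 2 - kq%:Z <= x <= 0 -> D x = 0) ->
  (forall x : int, N%:Z + 1 <= x <= N%:Z + kp%:Z - 1 -> D x = 0) ->
  (forall i, u i = \sum_(m < i) D m.+1%:Z) ->
  forall i, (0 < i < N)%N ->
     \sum_(1 <= l < k.+1)
       (p l * (u (minn (i + l) N) - u i) + q l * (u (i - l)%N - u i)) = rl_gen D i%:Z.
Proof.
move=> D0l D0r Du i /andP[i_gt0 lt_iN]; rewrite big_nat /rl_gen [RHS]big_nat.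
have [_ _ p0] := rl_kmaxP p p_ge0 p_gt0; have [_ _ q0] := rl_kmaxP q q_ge0 q_gt0.
apply: eq_bigr => l /andP[l_gt0 le_lk]; rewrite !Du -mulrN; congr (_ + _).
  have [le_l | lt_l] := leqP l kp; first by rewrite clipped_sum_up.
  by rewrite p0 ?mul0r // lt_l.
have [le_l | lt_l] := leqP l kq; first by rewrite clipped_sum_down.
by rewrite q0 ?mul0r // lt_l.
Qed.

End Generator.

(** * Root multiplicities and determinants *)

Lemma size_sum_count_mem (T : eqType) (s t : seq T) :
  uniq t -> {subset s <= t} -> size s = (\sum_(z <- t) count_mem z s)%N.
Proof.
move=> uniq_t; elim: s => [|x s IHs] sub_st /=; first by rewrite big1.
rewrite big_split /= -IHs => [|z z_s]; last by apply: sub_st; rewrite inE z_s orbT.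
have -> : (\sum_(z <- t) (x == z))%N = count_mem x t.
  by rewrite -sumn_count sumnE big_map; apply: eq_bigr => z _; rewrite eq_sym.
by rewrite count_uniq_mem // sub_st ?mem_head.
Qed.

Lemma mup0_lowest_coef (F : fieldType) (g : {poly F}) (n : nat) :
  (forall j, (j < n)%N -> g`_j = 0) -> g`_n != 0 -> mup 0 g = n.
Proof.
move=> g0 gn; have nz_g : g != 0 by apply: contraNneq gn => ->; rewrite coef0.
have low0 m : (m <= mup 0 g)%N -> forall j, (j < m)%N -> g`_j = 0.
  rewrite mup_geq // polyC0 subr0 => /dvdpP[h ->] j lt_jm.
  by rewrite coefMXn lt_jm.
apply/eqP; rewrite eqn_leq mup_geq // leqNgt; apply/andP; split.
  by apply/negP => /low0/(_ n (ltnSn n)) gn0; rewrite gn0 eqxx in gn.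
rewrite polyC0 subr0 -(poly_take_drop n g).
suff -> : take_poly n g = 0 by rewrite add0r dvdp_mull.
by apply/polyP => j; rewrite coef_take_poly coef0; case: ifP => // /g0.
Qed.

(** Over an algebraically closed field [g] splits, and multiplicities become counts in its list of
    linear factors. *)
Lemma sum_mup_nonzero_roots (F : closedFieldType) (g : {poly F}) (zs : seq F) :
  g != 0 -> uniq zs ->
  (forall z, z \in zs -> z != 0 /\ root g z) ->
  (forall z, z != 0 -> root g z -> z \in zs) ->
  ((\sum_(z <- zs) mup z g) + mup 0 g)%N = (size g).-1.
Proof.
move=> nz_g uniq_zs zs_root zs_all.
have [rs Dg] := closed_field_poly_normal g.
have nz_lc : lead_coef g != 0 by rewrite lead_coef_eq0.
have mupE z : mup z g = count_mem z rs.
  rewrite Dg -mul_polyC mupMr ?mu_prod_XsubC //.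
  by rewrite rootC.
have size_g : size g = (size rs).+1 by rewrite Dg size_scale // size_prod_XsubC.
rewrite size_g /= (@size_sum_count_mem _ rs (0 :: zs)).
- rewrite big_cons addnC mupE; congr (_ + _)%N.
  by apply: eq_bigr => z _; rewrite mupE.
- by rewrite /= uniq_zs andbT; apply/negP => /zs_root[]; rewrite eqxx.
- move=> z z_rs; rewrite inE; have [// | nz_z] := eqVneq z 0.
  by rewrite zs_all // Dg rootZ // root_prod_XsubC.
Qed.

Lemma sum_indicator_shift (R : pzRingType) (s i n : nat) (F : nat -> R) :
  (s + i <= n)%N ->
  \sum_(b < n) ((s <= b)%N && (b < s + i)%N)%:R * F b = \sum_(m < i) F (s + m)%N.
Proof.
move=> /subnKC <-; rewrite -addnA big_split_ord /= big1 ?add0r => [|b _]; last first.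
  by rewrite leqNgt ltn_ord mul0r.
rewrite big_split_ord /= [X in _ + X]big1 ?addr0 => [|b _]; last first.
  by rewrite addnA ltnNge leq_addr andbF mul0r.
by apply: eq_bigr => m _; rewrite leq_addr ltn_add2l ltn_ord mul1r.
Qed.

Lemma sum_delta_ord (R : pzRingType) (a n : nat) (F : nat -> R) :
  (a < n)%N -> \sum_(b < n) (b == a :> nat)%:R * F b = F a.
Proof.
move=> lt_an; rewrite (bigD1 (Ordinal lt_an)) //= eqxx mul1r big1 ?addr0 // => b.
by rewrite -val_eqE => /negPf /= ->; rewrite mul0r.
Qed.

(* Read off the last coordinate of [\adj M *m (M *m y) = \det M *: y]. *)
Lemma det_last_coord (R : comPzRingType) (n : nat) (M : 'M[R]_n.+1)
    (y : 'cV[R]_n.+1) (v : R) :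
  y ord_max 0 = 1 -> (forall a, (M *m y) a 0 = if a == ord_max then v else 0) ->
  \det M = v * \det (row' ord_max (col' ord_max M)).
Proof.
move=> y1 My; have : (\adj M *m (M *m y)) ord_max 0 = \det M.
  by rewrite mulmxA mul_adj_mx mul_scalar_mx mxE y1 mulr1.
rewrite mxE (bigD1 ord_max) //= My eqxx big1 => [|a /negPf neq_a]; last first.
  by rewrite My neq_a mulr0.
by rewrite mxE /cofactor -signr_odd addnn odd_double expr0 mul1r addr0 mulrC => ->.
Qed.

(** * Determinants for the absorbing leap *)

Section LeapMatrices.
Context {C : archiClosedFieldType} (k N : nat) (p q : nat -> C) (zs : seq C).
Local Notation kp := (rl_kmax k p).
Local Notation kq := (rl_kmax k q).
Local Notation chi := (rl_char_poly k p q).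
Local Notation r := (rl_rnum k p q).
Local Notation zm := [seq (z, mup z chi) | z <- zs].
Local Notation row_pt := (rl_row_pt k p q).
Hypothesis k_gt0 : (0 < k)%N.
Hypothesis p_ge0 : forall j, (1 <= j <= k)%N -> 0 <= p j.
Hypothesis q_ge0 : forall j, (1 <= j <= k)%N -> 0 <= q j.
Hypothesis p_gt0 : 0 < \sum_(1 <= j < k.+1) p j.
Hypothesis q_gt0 : 0 < \sum_(1 <= j < k.+1) q j.

Lemma rl_char_coef_lead : rl_char_coef k p q (k + kp).-1 = p kp.
Proof.
have [/andP[kp_gt0 kp_le] _ p0] := rl_kmaxP _ p p_ge0 p_gt0.
rewrite /rl_char_coef ifF; last lia.
have -> : ((k + kp).-1 - k + 1)%N = kp by lia.
rewrite big_ltn // big_nat big1 ?addr0 // => l le_l; apply: p0; lia.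
Qed.

Lemma rl_char_coef_high j : (k + kp <= j)%N -> rl_char_coef k p q j = 0.
Proof.
have [/andP[kp_gt0 kp_le] _ p0] := rl_kmaxP _ p p_ge0 p_gt0.
move=> le_j; rewrite /rl_char_coef ifF; last lia.
rewrite big_nat big1 // => l le_l; apply: p0; lia.
Qed.

Lemma rl_char_coef_lowest : rl_char_coef k p q (k - kq) = - q kq.
Proof.
have [/andP[kq_gt0 kq_le] _ q0] := rl_kmaxP _ q q_ge0 q_gt0.
rewrite /rl_char_coef ifT; last lia.
rewrite subKn // big_ltn // big_nat big1 ?addr0 // => l le_l; apply: q0; lia.
Qed.

Lemma rl_char_coef_low j : (j < k - kq)%N -> rl_char_coef k p q j = 0.
Proof.
have [/andP[kq_gt0 kq_le] _ q0] := rl_kmaxP _ q q_ge0 q_gt0.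
move=> lt_j; rewrite /rl_char_coef ifT; last lia.
rewrite big_nat big1 ?oppr0 // => l le_l; apply: q0; lia.
Qed.

Lemma size_rl_char_poly : size chi = (k + kp)%N.
Proof.
have [/andP[kp_gt0 kp_le] hp _] := rl_kmaxP _ p p_ge0 p_gt0.
apply/eqP; rewrite eqn_leq; apply/andP; split.
  apply/leq_sizeP => j le_j; rewrite coef_poly rl_char_coef_high //.
  by case: ifP.
rewrite leqNgt; apply/negP => lt_chi.
have /leq_sizeP/(_ (k + kp).-1 (leqnn _)) : (size chi <= (k + kp).-1)%N by lia.
rewrite coef_poly ifT; last lia.
by rewrite rl_char_coef_lead => p0; rewrite p0 ltxx in hp.
Qed.

Lemma rl_char_poly_neq0 : chi != 0.
Proof. by rewrite -size_poly_eq0 size_rl_char_poly; lia. Qed.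

Hypothesis zs_uniq : uniq zs.
Hypothesis zs_roots : forall z, z \in zs -> z != 0 /\ root chi z.
Hypothesis zs_all : forall z : C, z != 0 -> root chi z -> z \in zs.

(** The degree of [chi] is [k + kp - 1] and its order at 0 is [k - kq]. The difference is [r], so
    the blocks of [Z] fill its columns exactly. *)
Lemma sumn_mult_roots : sumn (unzip2 zm) = r.
Proof.
have [/andP[kp_gt0 kp_le] _ _] := rl_kmaxP _ p p_ge0 p_gt0.
have [/andP[kq_gt0 kq_le] hq _] := rl_kmaxP _ q q_ge0 q_gt0.
have := sum_mup_nonzero_roots _ _ _ rl_char_poly_neq0 zs_uniq zs_roots zs_all.
rewrite (@mup0_lowest_coef _ _ (k - kq)) => [|j lt_j|]; last first.
- by rewrite coef_poly ifT ?rl_char_coef_lowest ?oppr_eq0 ?gt_eqF //; lia.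
- by rewrite coef_poly ifT ?rl_char_coef_low //; lia.
rewrite size_rl_char_poly /unzip2 -map_comp sumnE big_map /rl_rnum.
by move=> sum_mup; apply: (@addIn (k - kq)%N); apply: etrans sum_mup _; lia.
Qed.

Lemma rl_gen_zcol_roots c x : rl_gen k p q (rl_zcol zm c) x = 0.
Proof.
apply: rl_gen_zcol => // z m /mapP[z' z'_zs [-> ->]]; split.
  by have [] := zs_roots _ z'_zs.
by rewrite -mup_geq ?rl_char_poly_neq0.
Qed.

Lemma zcol_roots_free (a : 'I_r -> C) x :
  (forall i, (i < r)%N -> \sum_(c < r) a c * rl_zcol zm c (x + i%:Z) = 0) ->
  forall c, a c = 0.
Proof.
(* [a'] extends [a] by 0 to all naturals, the form in which [zcol_free] takes coefficients. *)
move=> comb0 c; pose a' n := if insub n is Some c' then a c' else 0.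
have a'E (d : 'I_r) : a' d = a d by rewrite /a' valK.
rewrite -a'E; apply: (@zcol_free _ zm a' x); rewrite ?sumn_mult_roots //.
- by rewrite /unzip1 -map_comp map_id.
- by move=> z; rewrite /unzip1 -map_comp map_id => /zs_roots[].
- by move=> i lt_ir; rewrite -[RHS](comb0 i lt_ir); apply: eq_bigr => d _; rewrite a'E.
Qed.

Hypothesis leN : (kp + kq <= N)%N.

(** Column [kq - 1] stands for the point 1, so the ones of the middle row cover the points 1 to [i],
    while each outer row selects a single point. *)
Lemma acc_sum (D : int -> C) (i a : nat) : (i <= N)%N -> (a < r)%N ->
  \sum_(b < rl_dimZ k N p q) rl_acc_entry k N p q i a b * D (row_pt b) =
  if (a < kq - 1)%N then D (a%:Z + 2 - kq%:Z)
  else if (a == kq - 1)%N then \sum_(m < i) D m.+1%:Z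
  else D (a%:Z + N%:Z + 1 - kq%:Z).
Proof.
have [/andP[kp_gt0 kp_le] _ _] := rl_kmaxP _ p p_ge0 p_gt0.
have [/andP[kq_gt0 kq_le] _ _] := rl_kmaxP _ q q_ge0 q_gt0.
rewrite /rl_dimZ /rl_acc_entry /rl_rnum => le_iN lt_ar.
case: ifP => [lt_a | ge_a].
  under eq_bigr do rewrite eq_sym.
  by rewrite (sum_delta_ord _ _ _ (fun b => D (row_pt b))) //; lia.
case: ifP => [/eqP Da | neq_a].
  rewrite (sum_indicator_shift _ _ _ _ (fun b => D (row_pt b))); last lia.
  by apply: eq_bigr => m _; rewrite /rl_row_pt; congr D; lia.
rewrite (sum_delta_ord _ _ _ (fun b => D (row_pt b))); last lia.
by rewrite /rl_row_pt; congr D; lia.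
Qed.

Lemma acc_sum_eq0 (D : int -> C) :
  (forall a, (a < r)%N ->
    \sum_(b < rl_dimZ k N p q) rl_acc_entry k N p q N a b * D (row_pt b) = 0) ->
  [/\ forall x : int, 2 - kq%:Z <= x <= 0 -> D x = 0,
      forall x : int, N%:Z + 1 <= x <= N%:Z + kp%:Z - 1 -> D x = 0 &
      \sum_(m < N) D m.+1%:Z = 0].
Proof.
have [/andP[kp_gt0 kp_le] _ _] := rl_kmaxP _ p p_ge0 p_gt0.
have [/andP[kq_gt0 kq_le] _ _] := rl_kmaxP _ q q_ge0 q_gt0.
rewrite /rl_rnum => acc0; split.
(* The row selecting [x] is found by solving [a + 2 - kq = x]; on the right of [N] the equation is
   [a + N + 1 - kq = x]. *)
- move=> x le_x; have lt_a : (absz (x - 2 + kq%:Z)%R < (kp + kq).-1)%N by lia.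
  have := acc0 _ lt_a; rewrite acc_sum // ifT; last lia.
  by move=> <-; congr D; lia.
- move=> x le_x; have lt_a : (absz (x - N%:Z - 1 + kq%:Z)%R < (kp + kq).-1)%N by lia.
  have := acc0 _ lt_a; rewrite acc_sum // ifF ?ifF; try lia.
  by move=> <-; congr D; lia.
- have lt_a : (kq - 1 < (kp + kq).-1)%N by lia.
  by have := acc0 _ lt_a; rewrite acc_sum // ltnn eqxx.
Qed.

Hypothesis pq_sum1 : \sum_(1 <= j < k.+1) (p j + q j) = 1.

Lemma mul_accordion_Zmat (w : 'cV[C]_r) (a : 'I_r) :
  (rl_Amat k N p q N *m rl_Zmat k N p q zs *m w) a 0 =
  \sum_(b < rl_dimZ k N p q) rl_acc_entry k N p q N a b *
    \sum_(c < r) w c 0 * rl_zcol zm c (row_pt b).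
Proof.
rewrite -mulmxA mxE; apply: eq_bigr => b _; rewrite !mxE; congr (_ * _).
by apply: eq_bigr => c _; rewrite mxE mulrC.
Qed.

Lemma det_accordion_neq0 : \det (rl_Amat k N p q N *m rl_Zmat k N p q zs) != 0.
Proof.
have [/andP[kp_gt0 kp_le] _ _] := rl_kmaxP _ p p_ge0 p_gt0.
have [/andP[kq_gt0 kq_le] _ _] := rl_kmaxP _ q q_ge0 q_gt0.
(* [det0P] provides a row vector in the left kernel; transposing makes it a right kernel vector. *)
rewrite -det_tr; apply/det0P => -[v nz_v vA0].
have {vA0} Aw0 : rl_Amat k N p q N *m rl_Zmat k N p q zs *m v^T = 0.
  by apply: trmx_inj; rewrite trmx_mul trmxK vA0 trmx0.
pose D (x : int) := \sum_(c < r) v^T c 0 * rl_zcol zm c x.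
have acc0 a : (a < r)%N ->
    \sum_(b < rl_dimZ k N p q) rl_acc_entry k N p q N a b * D (row_pt b) = 0.
  by move=> lt_ar; rewrite -(mul_accordion_Zmat v^T (Ordinal lt_ar)) Aw0 mxE.
have [D0l D0r sumD0] := acc_sum_eq0 D acc0.
have genD x : rl_gen k p q D x = 0.
  rewrite (rl_gen_lincomb _ _ _ _ (fun c => v^T c 0) (fun c => rl_zcol zm c)).
  by rewrite big1 // => c _; rewrite rl_gen_zcol_roots mulr0.
pose u n := \sum_(m < n) D m.+1%:Z.
have u0 n : (n <= N)%N -> u n = 0.
  apply: (harmonic_eq0 k N p q p_ge0 q_ge0 pq_sum1 p_gt0) => //; first exact: big_ord0.
  move=> i int_i; rewrite -[RHS](genD i%:Z).
  exact: (clipped_gen k N p q p_ge0 q_ge0 p_gt0 q_gt0 D u).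
(* At the points 1 to [N] the increment is a difference of two values of [u], all of which are 0. *)
have D0 x : 2 - kq%:Z <= x <= N%:Z + kp%:Z - 1 -> D x = 0.
  move=> le_x; have [x_le0 | x_gt0] := leP x 0; first by apply: D0l; lia.
  have [x_leN | x_gtN] := leP x N%:Z; last by apply: D0r; lia.
  case: x x_gt0 x_leN {le_x} => [[|n]|n] // _ le_nN.
  have := u0 n.+1 le_nN; rewrite /u big_ord_recr /= -/(u n) u0 ?add0r //.
  exact: ltnW.
case/negP: nz_v; apply/eqP/rowP => c; rewrite [RHS]mxE.
have <- : v^T c 0 = v 0 c by rewrite mxE.
(* There are [N + r - 1 >= r] consecutive zeros of [D], enough for independence of the columns. *)
apply: (@zcol_roots_free (fun c => v^T c 0) (2 - kq%:Z)) => i lt_ir.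
by apply: D0; move: lt_ir; rewrite /rl_rnum; lia.
Qed.

Lemma expected_absorption_time_det (i : 'I_N.+1) :
  expected_absorption_time k N p q i
    (\det (rl_Astar k N p q i *m rl_Zstar k N p q zs)
       / \det (rl_Amat k N p q N *m rl_Zmat k N p q zs)).
Proof.
have [/andP[kp_gt0 kp_le] _ _] := rl_kmaxP _ p p_ge0 p_gt0.
have [/andP[kq_gt0 kq_le] _ _] := rl_kmaxP _ q q_ge0 q_gt0.
set M := rl_Amat k N p q N *m _; have nz_M : \det M != 0 := det_accordion_neq0.
pose delta : 'cV[C]_r := \col_a
  \sum_(b < rl_dimZ k N p q) rl_acc_entry k N p q N a b * rl_delta_entry k p q (row_pt b).
(* The solution of [M *m w + delta = 0], so that every row of the accordion matrix annihilates
   [D]. *)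
pose w := - (invmx M *m delta).
pose D x := \sum_(c < r) w c 0 * rl_zcol zm c x + rl_delta_entry k p q x.
have acc0 a : (a < r)%N ->
    \sum_(b < rl_dimZ k N p q) rl_acc_entry k N p q N a b * D (row_pt b) = 0.
  move=> lt_ar; under eq_bigr do rewrite mulrDr.
  rewrite big_split /= -(mul_accordion_Zmat w (Ordinal lt_ar)) /w mulmxN mulmxA.
  by rewrite mulmxV ?unitmxE ?unitfE // mul1mx !mxE addNr.
have [D0l D0r sumD0] := acc_sum_eq0 D acc0.
have genD x : rl_gen k p q D x = -1.
  rewrite rl_genD rl_gen_delta //.
  rewrite (rl_gen_lincomb _ _ _ _ (fun c => w c 0) (fun c => rl_zcol zm c)).
  by rewrite big1 ?add0r // => c _; rewrite rl_gen_zcol_roots mulr0.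
pose u n := \sum_(m < n) D m.+1%:Z.
(* [y] is [w] followed by 1, the coefficient of the column [delta] of [Z*]. *)
pose y : 'cV[C]_r.+1 := \col_c (if unlift ord_max c is Some c' then w c' 0 else 1).
have Zy b : (rl_Zstar k N p q zs *m y) b 0 = D (row_pt b).
  rewrite mxE big_ord_recr /= !mxE unlift_none ltnn mulr1; congr (_ + _).
  apply: eq_bigr => c _; have -> : widen_ord (leqnSn r) c = lift ord_max c.
    by apply: ord_inj; rewrite lift_max.
  by rewrite [X in X * _ = _]mxE [X in _ * X = _]mxE liftK lift_max ltn_ord mulrC.
have -> : \det (rl_Astar k N p q i *m rl_Zstar k N p q zs) / \det M = u i.
  (* The first [r] coordinates of [A*_i Z* y] vanish by the choice of [w], the last is [u i], and
     deleting the last row and column leaves [M]. *)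
  rewrite (@det_last_coord _ _ _ y (u i)) => [||a].
  - have -> : row' ord_max (col' ord_max
        (rl_Astar k N p q i *m rl_Zstar k N p q zs)) = M.
      apply/matrixP => a c; rewrite !mxE; apply: eq_bigr => b _.
      by rewrite !mxE !lift_max !ltn_ord.
    by rewrite mulfK.
  - by rewrite mxE unlift_none.
  rewrite -mulmxA mxE; under eq_bigr do rewrite Zy mxE.
  have [-> | neq_a] := eqVneq a ord_max.
    rewrite /= ltnn acc_sum ?ltnn ?eqxx //; first by rewrite -ltnS.
    by rewrite /rl_rnum; lia.
  have lt_ar : (a < r)%N.
    rewrite ltn_neqAle -ltnS ltn_ord andbT.
    by apply: contraNneq neq_a => Da; apply/eqP/val_inj.
  by rewrite lt_ar acc0.
apply: absorption_time_potential => //; first exact: big_ord0.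
move=> j int_j; rewrite -[RHS](genD j%:Z).
exact: (clipped_gen k N p q p_ge0 q_ge0 p_gt0 q_gt0 D u).
Qed.

End LeapMatrices.

Theorem mainTheorem3 (C : archiClosedFieldType) (k : nat) (p q : nat -> C)
  (hk : (1 <= k)%N)
  (hp : forall j, (1 <= j <= k)%N -> 0 <= p j)
  (hq : forall j, (1 <= j <= k)%N -> 0 <= q j)
  (hsum : \sum_(1 <= j < k.+1) (p j + q j) = 1)
  (hsp : 0 < \sum_(1 <= j < k.+1) p j)
  (hsq : 0 < \sum_(1 <= j < k.+1) q j)
  (N : nat) (hN : (rl_kmax k p + rl_kmax k q <= N)%N)
  (zs : seq C)
  (hzs_uniq : uniq zs)
  (hzs_roots : forall z, z \in zs -> z != 0 /\ root (rl_char_poly k p q) z)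
  (hzs_all : forall z, z != 0 -> root (rl_char_poly k p q) z -> z \in zs) :
  \det (rl_Amat k N p q N *m rl_Zmat k N p q zs) != 0 /\
  forall i : 'I_N.+1,
    expected_absorption_time k N p q i
      (\det (rl_Astar k N p q i *m rl_Zstar k N p q zs)
         / \det (rl_Amat k N p q N *m rl_Zmat k N p q zs)).
Proof.
by split=> [|i]; [apply: det_accordion_neq0 | apply: expected_absorption_time_det].
Qed.
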